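(* For every integer $n\ge 1$, the sixth factorial moment of the area statistic on parking functions of length $n$ is $$\mathbb{E}\Big[\prod_{j=0}^{5}(\mathrm{Area}-j)\Big]=\frac{82825}{576576}n^{9}+\frac{373340075}{110702592}n^{8}+\frac{9401544029}{332107776}n^{7}+\frac{14473244813}{127733760}n^{6}+\frac{414139396709}{1660538880}n^{5}$$ $$+\frac{88215445651}{332107776}n^{4}-\frac{18783816473}{332107776}n^{3}-\frac{643359542029}{1660538880}n^{2}-\frac{358936540409}{1660538880}n$$ $$+\Big(-\frac{3955}{2048}n^{7}-\frac{186349}{6144}n^{6}-\frac{259283273}{1161216}n^{5}-\frac{119912501}{129024}n^{4}-\frac{149860633081}{63866880}n^{3}$$ $$-\frac{601794266581}{166053888}n^{2}-\frac{864000570107}{276756480}n-\frac{921390308389}{830269440}\Big)E_1(n),$$ and asymptotically it equals $\frac{82825}{576576}n^{9}+O(n^{17/2})$ as $n\to\infty$.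
   Context: A parking function of length $n$ is a vector $(p_1,\dots,p_n)$ of positive integers such that its weakly increasing rearrangement $p_{(1)}\le p_{(2)}\le\dots\le p_{(n)}$ satisfies $p_{(i)}\le i$ for all $1\le i\le n$. There are $(n+1)^{n-1}$ of them. The area statistic is $\mathrm{Area}(p)=\frac{n(n+1)}{2}-\sum_{i=1}^n p_i$. Expectations are taken with respect to the uniform distribution on the set of parking functions of length $n$; the $k$-th factorial moment is $\mathbb{E}[\mathrm{Area}(\mathrm{Area}-1)\cdots(\mathrm{Area}-k+1)]$. Here $E_1(n)$ denotes $$E_1(n)= -\frac{n}{2}+\frac{1}{2}\,\frac{(n+1)!}{(n+1)^{n}}\sum_{k=0}^{n-1}\frac{(n+1)^k}{k!},$$ which is the expectation of the area statistic on parking functions of length $n$. *)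

(* Defs.v *)
From HB Require Import structures.
From mathcomp Require Import all_boot all_order all_algebra.
From mathcomp Require Import all_classical all_reals all_analysis.
Set Implicit Arguments.
Unset Strict Implicit.
Unset Printing Implicit Defensive.
Import Order.TTheory GRing.Theory Num.Theory.
Import numFieldNormedType.Exports.
Local Open Scope ring_scope.

(* A literal such as 82825%:R is kept as the binary-size term                 *)
(* (Nat.of_num_uint 82825)%:R, which ring, field and lra understand; without  *)
(* %:R, ring_scope would expand it to a unary numeral.  The scope makes it    *)
(* print in that form rather than digit constructor by digit constructor.     *)
Delimit Scope dec_uint_scope with uint.
Arguments Nat.of_num_uint d%_dec_uint_scope.
#[export] Set Warnings "-abstract-large-number".

(* sort leq p is indexed from 0, so its entry i is p_(i+1). *)
Definition parking_function (p : seq nat) : bool :=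
  all (leq 1) p
  && [forall i : 'I_(size p), (nth 0 (sort leq p) i <= i.+1)%N].

(* Entries of a parking function of length n are at most n, so restricting    *)
(* them to the finite type 'I_n.+1 = {0, ..., n} loses nothing; see           *)
(* parking_functionsP.                                                        *)
Definition parking_functions (n : nat) : {set n.-tuple 'I_n.+1} :=
  [set p : n.-tuple 'I_n.+1 | parking_function [seq val x | x <- p]].

Lemma parking_functionsP (n : nat) (s : n.-tuple nat) :
  reflect (exists2 p, p \in parking_functions n & val s = [seq val x | x <- p])
          (parking_function s).
Proof.
apply: (iffP idP) => [pf|[p]]; last by rewrite inE => pf ->.
have sub x : x \in val s -> (x < n.+1)%N.
  rewrite -(mem_sort leq) => /(nthP 0%N)[i]; rewrite size_sort => lti <-.
  rewrite ltnS; case/andP: pf => _ /forallP/(_ (Ordinal lti))/leq_trans; apply.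
  by rewrite -[leqRHS](size_tuple s).
have mapK : val s = [seq val x | x <- map_tuple (fun x : nat => inord x : 'I_n.+1) s].
  rewrite /= -map_comp -[LHS]map_id; apply/eq_in_map => x /sub ltx /=.
  by rewrite inordK.
exists (map_tuple (fun x : nat => inord x : 'I_n.+1) s) => //.
by rewrite inE -mapK.
Qed.

Definition area (R : numFieldType) (n : nat) (p : n.-tuple 'I_n.+1) : R :=
  n%:R * n.+1%:R / 2%:R - \sum_(i < n) (tnth p i)%:R.

Definition uniform_expectation (R : numFieldType) (T : finType) (A : {set T})
    (X : T -> R) : R :=
  (\sum_(t in A) X t) / #|A|%:R.

Definition area_factorial_moment (R : numFieldType) (n k : nat) : R :=
  uniform_expectation (parking_functions n)
    (fun p => \prod_(j < k) (area R p - j%:R)).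

Definition E1 (R : numFieldType) (n : nat) : R :=
  - (n%:R / 2%:R)
  + 1 / 2%:R * ((n.+1)`!%:R / n.+1%:R ^+ n)
    * \sum_(k < n) n.+1%:R ^+ k / k`!%:R.

(* Main.v *)
Require Import Defs.
From Stdlib Require Import BinInt.
From HB Require Import structures.
From mathcomp Require Import all_boot all_order all_algebra.
From mathcomp Require Import all_classical all_reals all_analysis.
From mathcomp Require Import zify ssrZ ring lra.
Import Order.TTheory GRing.Theory Num.Theory.
Import numFieldNormedType.Exports.
Set Implicit Arguments.
Unset Strict Implicit.
Unset Printing Implicit Defensive.
Delimit Scope Z_scope with BZ.
Local Open Scope classical_set_scope.
Local Open Scope ring_scope.

(* Counting parking functions of length n by area, with q = 1 + t, gives t^(-n) times
   the enumerator by edges of the connected graphs on n + 1 labelled vertices, so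
   the k-th factorial moment is k! times the number of such graphs of excess k - 1,
   divided by (n+1)^(n-1).  Splitting words according to the number of their
   smallest letters yields the relation Phi E = E' with E = sum_n q^C(n,2) z^n/n!,
   hence Phi' = Phi (q Phi(qz) - Phi).  Extracting the coefficient of t^j gives
   Wright's recursion for the series A_j of pointed connected graphs of excess
   j - 1: a first order linear differential equation whose solution is a Laurent
   polynomial in u = 1/(1 - T), where T is the tree function.  The solutions for
   j <= 6 are checked by integer arithmetic.  Coefficients of powers of u satisfy
   [u^(k+2)] = [u^(k+1)] + (n/k) [u^k], so they all reduce to those of u and u^2,
   and the latter is E_1 up to elementary factors.  The asymptotics follow from
   E_1(n) = O(n^(3/2)). *)

(** * Exponential generating functions *)

(** The sequence [a] stands for the series with terms a_n z^n/n!, so that differentiation is a shift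
    and coefficients are the counts themselves. *)
Definition hseries (K : Type) := nat -> K.

HB.instance Definition _ (K : zmodType) :=
  GRing.Zmodule.copy (hseries K) (nat -> K).

Lemma sum_binS (V : nmodType) (G : nat -> nat -> V) n :
  \sum_(k < n.+2) G k (n.+1 - k)%N *+ 'C(n.+1, k) =
  \sum_(k < n.+1) (G k.+1 (n - k)%N + G k (n - k).+1) *+ 'C(n, k).
Proof.
rewrite big_ord_recl bin0 mulr1n subn0 /=.
under eq_bigr => k _ do rewrite /bump /= add1n binS subSS mulrnDr.
under [RHS]eq_bigr => k _ do rewrite mulrnDl.
rewrite !big_split /= addrA addrC; congr (_ + _).
rewrite [RHS]big_ord_recl bin0 mulr1n subn0 /=; congr (_ + _).
rewrite big_ord_recr /= bin_small // mulr0n addr0.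
by apply: eq_bigr => k _; rewrite /bump /= add1n -subSn.
Qed.

Section HurwitzSeries.
Variable K : comNzRingType.
Implicit Types (a b c : hseries K) (B : nat -> hseries K).

Definition hder a : hseries K := fun n => a n.+1.
Definition htheta a : hseries K := fun n => a n *+ n.

(** A binomial convolution whose second factor [B k] may depend on the summation index; the product
    is the case of constant [B]. Building the Leibniz rule into the recursion makes [hder_star] hold
    by computation. *)
Fixpoint hstar_rec n (g : nat -> K) B : K :=
  if n is m.+1 then
    hstar_rec m (fun k => g k.+1) (fun k => B k.+1)
    + hstar_rec m g (fun k => hder (B k))
  else g 0%N * B 0%N 0%N.

Definition hstar g B : hseries K := fun n => hstar_rec n g B.

Definition hmul a b : hseries K := hstar a (fun=> b).

Lemma hseriesP a b : (forall n, a n = b n) -> a = b.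
Proof. by move=> eq_ab; apply: functional_extensionality_dep. Qed.

Lemma hDE a b n : (a + b) n = a n + b n. Proof. by []. Qed.

Lemma hNE a n : (- a) n = - a n. Proof. by []. Qed.

Lemma hder_star g B :
  hder (hstar g B) = hstar (fun k => g k.+1) (fun k => B k.+1)
                     + hstar g (fun k => hder (B k)).
Proof. by []. Qed.

Lemma hder_mul a b : hder (hmul a b) = hmul (hder a) b + hmul a (hder b).
Proof. by []. Qed.

Lemma hstarE g B n :
  hstar g B n = \sum_(k < n.+1) (g k * B k (n - k)%N) *+ 'C(n, k).
Proof.
elim: n g B => [|n IHn] g B; first by rewrite big_ord1 bin0.
rewrite [LHS]/= -/(hstar _ _ _) -/(hstar g _ _) !IHn.
rewrite (sum_binS (fun k m => g k * B k m)) -big_split /=.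
by apply: eq_bigr => k _; rewrite mulrnDl.
Qed.

Lemma hmulE a b n :
  hmul a b n = \sum_(k < n.+1) (a k * b (n - k)%N) *+ 'C(n, k).
Proof. exact: hstarE. Qed.

(** The Leibniz rule reduces the coefficient n + 1 of a product to coefficients n of products, so
    induction on the index suffices. *)
Lemma hmulC : commutative hmul.
Proof.
move=> a b; apply: hseriesP => n; elim: n a b => [|n IHn] a b.
  exact: mulrC.
rewrite -[LHS]/(hder (hmul a b) n) -[RHS]/(hder (hmul b a) n) !hder_mul addrC.
by rewrite !hDE [in LHS]IHn [X in _ + X]IHn.
Qed.

Lemma hmulDl : left_distributive hmul +%R.
Proof.
move=> a b c; apply: hseriesP => n; rewrite hDE !hmulE -big_split /=.
by apply: eq_bigr => k _; rewrite mulrDl mulrnDl.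
Qed.

(** Associativity for an index-dependent factor, by the same induction; it lets the graph series be
    multiplied into the recursion on words. *)
Lemma hstar_mul g B b : hmul (hstar g B) b = hstar g (fun k => hmul (B k) b).
Proof.
apply: hseriesP => n; elim: n g B b => [|n IHn] g B b.
  by rewrite /hmul /hstar /= mulrA.
rewrite -[LHS]/(hder (hmul (hstar g B) b) n) hder_mul hder_star hmulDl !hDE !IHn.
rewrite -[RHS]/(hder (hstar g _) n) hder_star hDE.
rewrite -addrA; congr (_ + _); rewrite !hstarE -big_split.
apply: eq_bigr => k _; rewrite /= -mulrnDl -mulrDr; congr (_ * _ *+ _).
Qed.

Lemma hmulA : associative hmul.
Proof.
by move=> a b c; rewrite [X in _ = X]hstar_mul.
Qed.

Definition hone : hseries K := fun n => (n == 0%N)%:R.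

Lemma hmul1 : left_id hone hmul.
Proof.
move=> a; apply: hseriesP => n.
rewrite hmulE big_ord_recl big1 => [|i _]; last by rewrite mul0r mul0rn.
by rewrite mul1r subn0 bin0 addr0.
Qed.

Lemma hone_neq0 : hone != 0.
Proof. by apply/eqP => /(congr1 (@^~ 0%N)) /eqP; rewrite oner_eq0. Qed.

HB.instance Definition _ := GRing.Zmodule_isComNzRing.Build (hseries K)
  hmulA hmulC hmul1 hmulDl hone_neq0.

Lemma hME a b n : (a * b) n = \sum_(k < n.+1) (a k * b (n - k)%N) *+ 'C(n, k).
Proof. exact: hmulE. Qed.

Lemma hderM a b : hder (a * b) = hder a * b + a * hder b.
Proof. by []. Qed.

Lemma hstarM g B b : hstar g B * b = hstar g (fun k => B k * b).
Proof. exact: hstar_mul. Qed.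

Lemma hsumE I (r : seq I) (P : pred I) (F : I -> hseries K) n :
  (\sum_(i <- r | P i) F i) n = \sum_(i <- r | P i) F i n.
Proof. by elim/big_rec2: _ => // i x y _ <-. Qed.

Lemma hMnE a m n : (a *+ m) n = a n *+ m.
Proof. by elim: m => // m IHm; rewrite !mulrS -IHm. Qed.

Lemma h1E n : (1 : hseries K) n = (n == 0%N)%:R. Proof. by []. Qed.

Lemma hnatE m n : (m%:R : hseries K) n = if n == 0%N then m%:R else 0.
Proof. by rewrite hMnE h1E; case: eqP => // _; rewrite mul0rn. Qed.

Lemma hnatME m a n : (m%:R * a) n = m%:R * a n.
Proof. by rewrite !mulr_natl hMnE. Qed.

Lemma hthetaM a b : htheta (a * b) = htheta a * b + a * htheta b.
Proof.
apply: hseriesP => n; rewrite !hDE /htheta !hME -sumrMnl -big_split /=.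
apply: eq_bigr => -[k /= lekn] _; rewrite mulrnAl mulrnAr -!mulrnA -mulrnDr.
by congr (_ *+ _); rewrite -mulnDl subnKC // mulnC.
Qed.

Lemma hthetaD a b : htheta (a + b) = htheta a + htheta b.
Proof. by apply: hseriesP => n; rewrite /htheta mulrnDl. Qed.

Lemma htheta0 : htheta 0 = 0.
Proof. by apply: hseriesP => n; rewrite /htheta mul0rn. Qed.

Lemma hthetaMn a m : htheta (a *+ m) = htheta a *+ m.
Proof. by apply: hseriesP => n; rewrite /htheta !hMnE mulrnAC. Qed.

Lemma htheta1 : htheta 1 = 0.
Proof. by apply: hseriesP => -[|n] //; apply: mul0rn. Qed.

Lemma hseries_mulIr a b : a 0%N = 1 -> b * a = 0 -> b = 0.
Proof.
move=> a0 ba0; apply: hseriesP => n; elim/ltn_ind: n => n IHn.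
have /(congr1 (@^~ n)) := ba0; rewrite hME big_ord_recr /= big1 => [|k _].
  by rewrite subnn a0 mulr1 binn add0r.
by rewrite IHn ?mul0r ?mul0rn.
Qed.

End HurwitzSeries.

(** * Words and the recursion on the number of smallest letters *)

Section Words.
Variable V : nmodType.
Implicit Types phi psi : seq nat -> V.

Fixpoint wsum (M n : nat) phi : V :=
  if n is m.+1 then \sum_(x < M) wsum M m (fun w => phi (val x :: w))
  else phi [::].

Lemma eq_wsum M n phi psi :
  (forall w, size w = n -> phi w = psi w) -> wsum M n phi = wsum M n psi.
Proof.
elim: n phi psi => [|n IHn] phi psi eq_phi /=; first exact: eq_phi.
by apply: eq_bigr => x _; apply: IHn => w sw; apply: eq_phi; rewrite /= sw.
Qed.

Lemma wsum_tuple M n phi :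
  wsum M n phi = \sum_(p : n.-tuple 'I_M) phi [seq val x | x <- p].
Proof.
elim: n phi => [|n IHn] phi /=.
  rewrite (big_pred1 [tuple]) //= => p; rewrite [p]tuple0; exact/esym/eqP.
under eq_bigr do rewrite IHn.
rewrite pair_big /= (reindex (fun p : n.+1.-tuple 'I_M =>
  (thead p, behead_tuple p))) /=.
  apply: eq_bigr => p _; rewrite [p in RHS]tuple_eta /=.
  by [].
exists (fun xp => cons_tuple xp.1 xp.2) => [p _|[x p] _] /=.
  by rewrite [RHS]tuple_eta; apply: val_inj.
by congr pair; apply: val_inj.
Qed.

(** For a symmetric [phi] only the number k of zeros matters: their positions account for 'C(n, k),
    and the other letters are successors. The induction removes the first letter and uses Pascal's
    rule. *)
Lemma wsum_zeros M n phi :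
    (forall s t, perm_eq s t -> phi s = phi t) ->
  wsum M.+1 n phi =
  \sum_(k < n.+1) wsum M (n - k) (fun w => phi (nseq k 0%N ++ map S w))
                  *+ 'C(n, k).
Proof.
elim: n phi => [|n IHn] phi phi_perm; first by rewrite big_ord1 bin0.
rewrite (sum_binS (fun k m => wsum M m (fun w => phi (nseq k 0%N ++ map S w)))).
rewrite [LHS]/= big_ord_recl.
under [RHS]eq_bigr => k _ do rewrite mulrnDl.
rewrite big_split; congr (_ + _).
  by rewrite IHn // => s t st; apply: phi_perm; rewrite perm_cons.
have step (x : 'I_M) (_ : true) := IHn (fun w => phi (x.+1 :: w))
  (fun s t st => phi_perm (x.+1 :: s) (x.+1 :: t) (etrans (perm_cons _ _ _) st)).
rewrite [LHS](eq_bigr _ step).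
rewrite exchange_big /=; apply: eq_bigr => k _; rewrite sumrMnl; congr (_ *+ _).
(* By symmetry a nonzero first letter moves behind the block of zeros. *)
apply: eq_bigr => x _; apply: eq_wsum => w _; apply: phi_perm.
by rewrite -cat1s perm_catCA.
Qed.

End Words.

(* With letters counted from 0, [bounded_sort a w] says that the i-th smallest
   letter (i >= 0) is less than a + i, so that a = 1 gives parking functions;
   [excess a w] is the total slack, which is the area when a = 1. *)
Definition bounded_sort (a : nat) (w : seq nat) : bool :=
  [forall i : 'I_(size w), (nth 0 (sort leq w) i < a + i)%N].

Definition excess (a : nat) (w : seq nat) : nat :=
  \sum_(i < size w) (a + i - (nth 0 (sort leq w) i).+1)%N.

Lemma sort_zeros k (w : seq nat) :
  sort leq (nseq k 0%N ++ map S w) = nseq k 0%N ++ map S (sort leq w).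
Proof.
apply: (sorted_eq leq_trans anti_leq); first exact: (sort_sorted leq_total).
  elim: k => [|k IHk] /=.
    by rewrite sorted_map; apply: (sort_sorted leq_total).
  by rewrite path_min_sorted //; apply/allP.
rewrite perm_sort perm_cat2l perm_map // perm_sym perm_sort //.
Qed.

Lemma bounded_sort_perm a s t :
  perm_eq s t -> bounded_sort a s = bounded_sort a t.
Proof.
move=> st; rewrite /bounded_sort (perm_size st).
by rewrite (perm_sortP leq_total leq_trans anti_leq _ _ st).
Qed.

Lemma excess_perm a s t : perm_eq s t -> excess a s = excess a t.
Proof.
move=> st; rewrite /excess (perm_size st).
by rewrite (perm_sortP leq_total leq_trans anti_leq _ _ st).
Qed.

Lemma nth_sort_zeros k w i : (i < k + size w)%N ->
  nth 0%N (sort leq (nseq k 0%N ++ map S w)) i =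
  if (i < k)%N then 0%N else (nth 0%N (sort leq w) (i - k)).+1.
Proof.
move=> lti; rewrite sort_zeros nth_cat size_nseq nth_nseq.
case: ltnP => // leki; rewrite (nth_map 0%N) // size_sort; lia.
Qed.

Lemma bounded_sort_zeros a k w :
  bounded_sort a.+1 (nseq k 0%N ++ map S w) = bounded_sort (a + k) w.
Proof.
have sz : size (nseq k 0%N ++ map S w) = (k + size w)%N.
  by rewrite size_cat size_nseq size_map.
apply/forallP/forallP => /= H i.
  have lti : (k + i < size (nseq k 0%N ++ map S w))%N by rewrite sz ltn_add2l.
  have := H (Ordinal lti); rewrite nth_sort_zeros -?sz //=.
  have -> : (k + i < k)%N = false by lia.
  by rewrite addKn; lia.
have lti : (i < k + size w)%N by rewrite -sz.
rewrite nth_sort_zeros //; case: (ltnP i k) => // leki.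
have ltik : (i - k < size w)%N by lia.
by have := H (Ordinal ltik) => /=; lia.
Qed.

(** The zero of index i has slack a + i, in total a k + 'C(k, 2). For the other letters, removing
    the zeros and lowering each letter by 1 turns the bound a + 1 into a + k. *)
Lemma excess_zeros a k w :
  excess a.+1 (nseq k 0%N ++ map S w) = (a * k + 'C(k, 2) + excess (a + k) w)%N.
Proof.
rewrite /excess size_cat size_nseq size_map big_split_ord /=; congr (_ + _)%N.
  rewrite -bin2_sum big_mkord -[k in (a * k)%N]card_ord mulnC -sum_nat_const.
  rewrite -big_split; apply: eq_bigr => i _.
  by rewrite nth_sort_zeros /= ?ltn_addr ?ltn_ord //; lia.
apply: eq_bigr => i _; rewrite nth_sort_zeros ?ltn_add2l //.
have -> : (k + i < k)%N = false by lia.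
by rewrite addKn; lia.
Qed.

(** * Enumerators of bounded words and their product with the graph series *)

Section WeightedWords.
Variables (K : comNzRingType) (t : K).
Notation q := (1 + t).

Definition weight a w : K :=
  if bounded_sort a w then t ^+ size w * q ^+ excess a w else 0.

(** The largest letter of a bounded word of length n is less than a + n - 1, so this alphabet is
    large enough. *)
Definition bounded_words a : hseries K := fun n => wsum (n + a).-1 n (weight a).

Lemma bounded_words0 a : bounded_words a 0%N = 1.
Proof.
rewrite /bounded_words /= /weight /bounded_sort /excess /= big_ord0 !expr0 mulr1.
by case: ifP => // /negP[]; apply/forallP => -[].
Qed.

Lemma wsum_eq0 M n (phi : seq nat -> K) :
  (forall w, size w = n -> phi w = 0) -> wsum M n phi = 0.
Proof.
move=> phi0; rewrite wsum_tuple big1 // => p _.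
by rewrite phi0 // size_map size_tuple.
Qed.

Lemma wsumMl M n (c : K) phi : wsum M n (fun w => c * phi w) = c * wsum M n phi.
Proof. by rewrite !wsum_tuple big_distrr. Qed.

Lemma bounded_words_0S n : bounded_words 0 n.+1 = 0.
Proof.
apply: wsum_eq0 => w sw; rewrite /weight; case: ifP => // /forallP H.
have lt0 : (0 < size w)%N by rewrite sw.
by have := H (Ordinal lt0).
Qed.

Lemma bounded_wordsS a n :
  bounded_words a.+1 n = \sum_(k < n.+1)
     (t ^+ k * q ^+ (a * k + 'C(k, 2)) * bounded_words (a + k) (n - k)%N)
      *+ 'C(n, k).
Proof.
case: n => [|n].
  by rewrite big_ord1 !bounded_words0 muln0 !expr0 !mulr1.
rewrite {1}/bounded_words.
have -> : (n.+1 + a.+1).-1 = (n + a).+1 by lia.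
rewrite wsum_zeros.
  apply: eq_bigr => k _; congr (_ *+ _); rewrite /bounded_words.
  have -> : (n.+1 - k + (a + k)).-1 = (n + a)%N by have := ltn_ord k; lia.
  rewrite -wsumMl; apply: eq_wsum => w sw.
  rewrite /weight bounded_sort_zeros excess_zeros size_cat size_nseq size_map.
  by case: ifP; rewrite ?mulr0 // => _; rewrite !exprD; ring.
move=> u v uv; rewrite /weight (bounded_sort_perm _ uv) (excess_perm _ uv).
by rewrite (perm_size uv).
Qed.

(** All graphs on n labelled vertices, each edge marked by t. *)
Definition graph_series : hseries K := fun n => q ^+ 'C(n, 2).

(** In series form Phi_a E = E(q^a z). Splitting by the number k of zeros reduces (a + 1, n) to (a +
    k, n - k), of smaller sum; the powers of q combine to q^('C(n, 2) + a n) for every k, and the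
    sum of 'C(n, k) t^k supplies the missing q^n. *)
Lemma bounded_words_graph a n :
  (bounded_words a * graph_series) n = q ^+ ('C(n, 2) + a * n).
Proof.
have [m] := ubnP (n + a)%N; elim: m n a => // m IHm n [|a] lt_m.
  rewrite hME big_ord_recl big1 => [|k _]; last first.
    by rewrite bounded_words_0S mul0r mul0rn.
  by rewrite addr0 bounded_words0 mul1r bin0 subn0 addn0.
have -> : bounded_words a.+1 =
    hstar (fun k => t ^+ k * q ^+ (a * k + 'C(k, 2)))
          (fun k => bounded_words (a + k)).
  by apply: hseriesP => j; rewrite hstarE bounded_wordsS.
rewrite hstarM hstarE.
have -> : ('C(n, 2) + a.+1 * n = ('C(n, 2) + a * n) + n)%N by lia.
rewrite [RHS]exprD [q ^+ n in RHS]exprDn big_distrr /=; apply: eq_bigr => k _.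
rewrite IHm ?mulrnAr; last by have := ltn_ord k; lia.
congr (_ *+ _); rewrite expr1n mul1r -mulrA -exprD mulrC; congr (q ^+ _ * _).
have := ltn_ord k; rewrite ltnS => lekn.
have -> : 'C(n, 2) = ('C(k, 2) + 'C(n - k, 2) + k * (n - k))%N.
  rewrite -{1}(subnK lekn); elim: (n - k)%N => [|j IHj]; first by rewrite muln0 !addn0.
  by rewrite addSn !binS IHj !bin1; lia.
by nia.
Qed.

Definition hdil (c : K) (a : hseries K) : hseries K := fun n => c ^+ n * a n.

(** Here Phi E = E' and E' = E(qz). Hence E'' = q E'(qz) = q Phi(qz) E', and comparing with (Phi E)'
    and cancelling E gives Phi' = Phi (q Phi(qz) - Phi). *)
Lemma bounded_words1_ode n :
  bounded_words 1 n.+1 = \sum_(k < n.+1)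
    (bounded_words 1 k * ((q ^+ (n - k).+1 - 1) * bounded_words 1 (n - k)%N))
      *+ 'C(n, k).
Proof.
pose P := bounded_words 1; pose E := graph_series.
have PE : P * E = hder E.
  apply: hseriesP => m; rewrite bounded_words_graph /hder /E /graph_series.
  by rewrite binS bin1 mul1n.
have dE : hder E = hdil q E.
  apply: hseriesP => m.
  by rewrite /hder /hdil /E /graph_series binS bin1 -exprD addnC.
(* [B] is q Phi(qz) - Phi, so [B + P] is q Phi(qz). *)
pose B : hseries K := fun m => (q ^+ m.+1 - 1) * P m.
have ddE : hder (hder E) = (B + P) * (P * E).
  rewrite PE {1}dE [in RHS]dE; apply: hseriesP => m.
  rewrite /hder {1}/hdil -/(hder E m) -PE !hME big_distrr; apply: eq_bigr => k _.
  rewrite hDE /B /hdil /= mulrnAr; congr (_ *+ _).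
  have -> : q ^+ m.+1 = q ^+ k.+1 * q ^+ (m - k).
    by rewrite -exprD addSn subnKC // -ltnS.
  by ring.
have ode : hder P = P * B.
  apply/eqP; rewrite -subr_eq0; apply/eqP.
  apply: (@hseries_mulIr _ E); first by rewrite /E /graph_series expr0.
  have -> : (hder P - P * B) * E = hder (P * E) - P * hder E - P * B * E.
    by rewrite hderM; ring.
  by rewrite PE ddE -PE; ring.
by rewrite -[LHS]/(hder P n) ode hME.
Qed.

End WeightedWords.

(** * The area polynomial *)

Lemma parking_function_S w : parking_function (map S w) = bounded_sort 1 w.
Proof.
rewrite /parking_function all_map (eq_all (a2 := predT)) // all_predT /=.
have sortS := sort_zeros 0 w; rewrite /= in sortS.
apply/forallP/forallP => H i.
  have lti : (i < size (map S w))%N by rewrite size_map.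
  by have := H (Ordinal lti); rewrite sortS (nth_map 0%N) //= size_sort.
have lti : (i < size w)%N by have := ltn_ord i; rewrite [X in (_ < X)%N]size_map.
by have := H (Ordinal lti); rewrite sortS (nth_map 0%N) //= size_sort.
Qed.

Lemma map_S_pred s : all (leq 1) s -> map S (map predn s) = s.
Proof.
move=> /allP s_gt0; rewrite -map_comp map_id_in // => x /s_gt0 x_gt0 /=.
by rewrite prednK.
Qed.

Lemma excess1_sumn s : parking_function s ->
  (excess 1 (map predn s) + sumn s)%N = \sum_(i < size s) i.+1.
Proof.
move=> pf_s; have /andP[s_gt0 _] := pf_s.
have sE := map_S_pred s_gt0; move: pf_s; rewrite -{}sE.
set w := map predn s; rewrite parking_function_S => /forallP bw.
have -> : map predn (map S w) = w by rewrite -map_comp map_id.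
have -> : sumn (map S w) = \sum_(i < size w) (nth 0 (sort leq w) i).+1.
  rewrite sumnE big_map -(perm_big _ (permEl (perm_sort leq w))).
  by rewrite (big_nth 0%N) size_sort big_mkord.
rewrite size_map -big_split; apply: eq_bigr => i _ /=.
(* The truncated subtraction in [excess] is exact because each sorted letter is below its bound. *)
by rewrite subnK //; apply: bw.
Qed.

Lemma sum_succ_ord n : (\sum_(i < n) i.+1 = 'C(n.+1, 2))%N.
Proof.
by rewrite -bin2_sum big_mkord big_ord_recl.
Qed.

Section AreaPolynomial.
Variable F : numFieldType.

Definition area_exponent n (p : n.-tuple 'I_n.+1) : nat :=
  excess 1 [seq predn (val x) | x <- p].

Definition area_poly n : {poly F} :=
  \sum_(p in parking_functions n) (1 + 'X) ^+ area_exponent p.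

Lemma areaE n (p : n.-tuple 'I_n.+1) : p \in parking_functions n ->
  area F p = (area_exponent p)%:R.
Proof.
rewrite inE => /excess1_sumn; rewrite -map_comp -/(area_exponent p).
rewrite size_map size_tuple sum_succ_ord => /(congr1 (fun m => m%:R : F)).
have -> : 'C(n.+1, 2)%:R = n%:R * n.+1%:R / 2%:R :> F.
  apply: (canRL (mulfK _)); first by rewrite pnatr_eq0.
  by rewrite -!natrM mulnC -mul_bin_diag bin1 mulnC.
rewrite natrD sumnE big_map big_tuple /area => <-.
rewrite [X in _ + X - _]natr_sum.
exact: addrK.
Qed.

Lemma prod_sub_ffact (m k : nat) :
  \prod_(j < k) (m%:R - j%:R) = (m ^_ k)%:R :> F.
Proof.
elim: k => [|k IHk]; first by rewrite big_ord0.
rewrite big_ord_recr IHk /= ffactnSr natrM.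
have [lekm|ltmk] := leqP k m; first by rewrite natrB.
by rewrite ffact_small // !mul0r.
Qed.

Lemma coef_1DX (m k : nat) : ((1 + 'X) ^+ m : {poly F})`_k = 'C(m, k)%:R.
Proof.
rewrite exprDn coef_sum.
under eq_bigr => i _ do rewrite expr1n mul1r coefMn coefXn.
have [lekm|ltmk] := leqP k m.
  rewrite (bigD1 (inord k)) //= inordK // eqxx big1 ?addr0 // => i.
  rewrite -val_eqE /= inordK // eq_sym => /negPf->.
  by rewrite mul0rn.
rewrite bin_small // big1 // => i _; rewrite gtn_eqF ?mul0rn //.
by rewrite (leq_ltn_trans _ ltmk) // -ltnS.
Qed.

(** The coefficient of X^k in (1 + X)^m is 'C(m, k), and k! 'C(m, k) is the falling factorial; the
    constant coefficient counts the parking functions. *)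
Lemma area_factorial_momentE n k :
  area_factorial_moment F n k =
  k`!%:R * (area_poly n)`_k / (area_poly n)`_0.
Proof.
rewrite /area_factorial_moment /uniform_expectation /area_poly !coef_sum.
congr (_ / _).
  rewrite big_distrr; apply: eq_bigr => p pf_p /=.
  by rewrite areaE // prod_sub_ffact coef_1DX -natrM mulnC bin_ffact.
under eq_bigr => p _ do rewrite coef_1DX bin0.
by rewrite sumr_const.
Qed.

(** A word over {0, ..., n} containing 0 is not a parking function, so only the term without zeros
    survives in [wsum_zeros], and there all letters are shifted by one. *)
Lemma bounded_words_area n : bounded_words 'X 1 n = 'X^n * area_poly n.
Proof.
pose psi w : {poly F} := if parking_function w
  then 'X^n * (1 + 'X) ^+ excess 1 (map predn w) else 0.
have -> : 'X^n * area_poly n = wsum n.+1 n psi.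
  rewrite wsum_tuple big_distrr big_mkcond; apply: eq_bigr => p _ /=.
  by rewrite inE /psi -map_comp.
rewrite wsum_zeros; last first.
  move=> s t st; rewrite /psi /parking_function (perm_all _ st) (perm_size st).
  rewrite (perm_sortP leq_total leq_trans anti_leq _ _ st).
  by rewrite (excess_perm 1 (perm_map predn st)).
rewrite big_ord_recl big1 ?addr0 => [|k _]; last first.
  by rewrite wsum_eq0 ?mul0rn // => w sw; rewrite /psi /parking_function.
rewrite bin0 subn0 /bounded_words addn1 /=; apply: eq_wsum => w sw.
rewrite /weight /psi parking_function_S sw -map_comp.
by rewrite (eq_map (g := id)) ?map_id.
Qed.

(** The q-integer (q^m - 1)/(q - 1) at q = 1 + X. *)
Definition bracket m : {poly F} := \poly_(i < m) 'C(m, i.+1)%:R.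

Lemma bracketE m : (1 + 'X) ^+ m - 1 = 'X * bracket m.
Proof.
apply/polyP => i; rewrite coefB coef_1DX coef1 coefXM coef_poly.
case: i => [|i]; first by rewrite bin0 subrr.
by rewrite subr0; case: ltnP => //= lemi; rewrite bin_small.
Qed.

Lemma coef_bracket m i : (bracket m)`_i = 'C(m, i.+1)%:R.
Proof. by rewrite coef_poly; case: ltnP => // lemi; rewrite bin_small. Qed.

Lemma area_poly_rec n :
  area_poly n.+1 = \sum_(k < n.+1)
    (area_poly k * (bracket (n - k).+1 * area_poly (n - k)%N)) *+ 'C(n, k).
Proof.
have Xn_neq0 : 'X ^+ n.+1 != 0 :> {poly F} by rewrite expf_neq0 // polyX_eq0.
apply: (mulfI Xn_neq0).
rewrite -bounded_words_area bounded_words1_ode big_distrr; apply: eq_bigr => k _.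
rewrite !bounded_words_area bracketE /= mulrnAr; congr (_ *+ _).
have -> : 'X ^+ n.+1 = 'X * 'X^k * 'X^(n - k) :> {poly F}.
  have lekn : (k <= n)%N by rewrite -ltnS.
  by rewrite exprS -mulrA -exprD subnKC.
by ring.
Qed.

(** * Wright's recursion, by extracting the coefficient of X^j *)

Definition hcoef j (a : hseries {poly F}) : hseries F := fun n => (a n)`_j.

(** The operator (z^i/i!) D^i. *)
Definition hbin (K : comNzRingType) i (a : hseries K) : hseries K :=
  fun n => a n *+ 'C(n, i).

Lemma hcoefM a b j :
  hcoef j (a * b) = \sum_(l < j.+1) hcoef l a * hcoef (j - l) b.
Proof.
apply: hseriesP => n; rewrite hsumE /hcoef hME coef_sum.
under [RHS]eq_bigr => l _ do rewrite hME.
rewrite exchange_big; apply: eq_bigr => k _ /=.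
by rewrite coefMn coefM sumrMnl.
Qed.

(** This is z times the series Phi of [area_poly]. The coefficient of X^j counts pointed connected
    graphs on n labelled vertices with n - 1 + j edges. *)
Definition area_hseries : hseries {poly F} := fun n => area_poly n.-1 *+ n.

Definition area_series j : hseries F := hcoef j area_hseries.

(** For A = z Phi one has theta A - A = z^2 Phi', and [area_poly_rec] factors Phi'; each factor
    absorbs one z. *)
Lemma area_hseries_ode :
  htheta area_hseries - area_hseries
  = area_hseries * (fun n => bracket n * area_hseries n).
Proof.
pose z : hseries {poly F} := fun n => (n == 1%N)%:R.
have zM (a : hseries {poly F}) n : (z * a) n = a n.-1 *+ n.
  rewrite hME; case: n => [|n]; first by rewrite big_ord1 mul0r mulr0n.
  rewrite !big_ord_recl big1 => [|i _]; last by rewrite mul0r mul0rn.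
  by rewrite mul0r mul0rn add0r addr0 mul1r subSS subn0 bin1.
pose P : hseries {poly F} := area_poly.
pose B : hseries {poly F} := fun n => bracket n.+1 * P n.
have odeP : hder P = P * B.
  by apply: hseriesP => n; rewrite hME /hder [LHS]area_poly_rec.
have -> : area_hseries = z * P by apply: hseriesP => n; rewrite zM.
have -> : (fun n => bracket n * (z * P) n) = z * B.
  apply: hseriesP => -[|n]; rewrite !zM /B ?mulr0n ?mulr0 //.
  by rewrite mulrnAr.
rewrite [RHS](_ : _ = z * (z * (P * B))); last by ring.
rewrite -odeP; apply: hseriesP => -[|[|n]]; rewrite hDE hNE /htheta !zM.
- by rewrite subrr.
- by rewrite subrr.
- rewrite /hder /= [RHS]mulrnAC; set x := P _ *+ n.+2.
  by rewrite [X in X - _](mulrSr x) addrK.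
Qed.

Lemma area_series_ode j :
  htheta (area_series j) - area_series j =
  \sum_(l < j.+1) area_series l *
     \sum_(i < (j - l).+1) hbin i.+1 (area_series (j - l - i)).
Proof.
have /(congr1 (hcoef j)) := area_hseries_ode; rewrite hcoefM.
have -> : hcoef j (htheta area_hseries - area_hseries)
          = htheta (area_series j) - area_series j.
  by apply: hseriesP => n; rewrite /hcoef hDE coefB coefMn.
move=> ->; apply: eq_bigr => l _; congr (_ * _).
apply: hseriesP => n; rewrite hsumE /hcoef coefM; apply: eq_bigr => i _.
by rewrite coef_bracket mulr_natl.
Qed.

Lemma area_series_0 j : area_series j 0%N = 0.
Proof. by rewrite /area_series /hcoef /area_hseries mulr0n coef0. Qed.

Lemma area_series_1 j : area_series j 1%N = (j == 0%N)%:R.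
Proof.
rewrite /area_series /hcoef /area_hseries /= mulr1n.
have := bounded_words_area 0; rewrite bounded_words0 mul1r => <-.
by rewrite coef1.
Qed.

End AreaPolynomial.

(** * The tree function and Abel's identity *)

Section TreeSeries.
Variable F : numFieldType.

Lemma hmul_order (K : comNzRingType) (a b : hseries K) i j :
    (forall n, (n < i)%N -> a n = 0) -> (forall n, (n < j)%N -> b n = 0) ->
  forall n, (n < i + j)%N -> (a * b) n = 0.
Proof.
move=> a0 b0 n ltn; rewrite hME big1 // => k _.
have [ltki|leik] := ltnP k i; first by rewrite a0 // mul0r mul0rn.
by rewrite b0 ?mulr0 ?mul0rn //; have := ltn_ord k; lia.
Qed.

Lemma hexp_order (K : comNzRingType) (a : hseries K) m : a 0%N = 0 ->
  forall n, (n < m)%N -> (a ^+ m) n = 0.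
Proof.
move=> a0; elim: m => // m IHm n ltn; rewrite exprS.
by apply: (@hmul_order _ _ _ 1 m) => // -[].
Qed.

(** This is the coefficient of z^j/j! in (1 - e^z)^m, a series of order at least m; [ex c] is
    e^(cz). *)
Lemma alternating_binomial_sum m j : (j < m)%N ->
  \sum_(k < m.+1) (-1) ^+ k * (k%:R ^+ j) *+ 'C(m, k) = 0 :> F.
Proof.
move=> ltjm; pose ex (c : F) : hseries F := fun n => c ^+ n.
have exD c d : ex (c + d) = ex c * ex d.
  apply: hseriesP => n; rewrite /ex addrC exprDn hME.
  by apply: eq_bigr => k _; rewrite mulrC.
have ex0 : ex 0 = 1 by apply: hseriesP => n; rewrite /ex expr0n.
have exX k : ex k%:R = ex 1 ^+ k.
  by elim: k => // k IHk; rewrite exprS -IHk -exD -natr1 addrC.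
have := @hexp_order _ (1 - ex 1) m _ j ltjm.
rewrite exprBn hsumE hDE hNE /ex expr0 h1E subrr => /(_ erefl) => sum0.
rewrite -[RHS]sum0; apply: eq_bigr => k _.
rewrite hMnE expr1n mulr1 -[ex 1 ^+ k]exX; congr (_ *+ _).
rewrite -(signr_odd (hseries F)) -(signr_odd F); case: (odd k).
  by rewrite !expr1 !mulN1r hNE.
by rewrite !expr0 !mul1r.
Qed.

Lemma deriv_eq (p r : {poly F}) : p^`() = r^`() -> p.[0] = r.[0] -> p = r.
Proof.
move=> dpr; rewrite !horner_coef0 => pr0; apply/polyP => -[//|i].
have /(congr1 (fun s : {poly F} => s`_i)) := dpr.
rewrite !coef_deriv => /eqP; rewrite -subr_eq0 -mulrnBl mulrn_eq0 /= subr_eq0.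
by move=> /eqP.
Qed.

(** Rooted labelled trees, n^(n-1) of them on n vertices. *)
Definition tree : hseries F := fun n => if n is m.+1 then n%:R ^+ m else 0.

(** Abel's identity. The derivative of the case m + 1 is m + 1 times the case m, so only the values
    at 0 remain to be compared. *)
Lemma abel_poly m :
  \sum_(k < m.+1) (tree k *+ 'C(m, k)) *: ('X - (k%:R)%:P) ^+ (m - k)
  = m%:R *: 'X ^+ m.-1.
Proof.
elim: m => [|m IHm]; first by rewrite big_ord1 mul0rn !scale0r.
apply: deriv_eq.
  have -> : (m.+1%:R *: 'X ^+ m.+1.-1)^`() = m.+1%:R *: (m%:R *: 'X ^+ m.-1) :> {poly F}.
    by rewrite derivZ derivXn /= (scaler_nat m).
  rewrite -IHm scaler_sumr raddf_sum big_ord_recr /= subnn expr0 derivZ derivC.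
  rewrite scaler0 addr0; apply: eq_bigr => k _ /=.
  rewrite derivZ deriv_exp derivB derivX derivC subr0 mul1r.
  have lekm : (k <= m)%N by rewrite -ltnS.
  have binE : ('C(m.+1, k) * (m - k).+1 = 'C(m, k) * m.+1)%N.
    by rewrite mulnC -subSn // -mul_bin_down mulnC.
  rewrite subSn //= -scalerMnr scalerMnl -mulrnA binE.
  by rewrite scalerA mulr_natl -mulrnA.
rewrite hornerZ hornerXn horner_sum.
case: m {IHm} => [|m].
  rewrite !big_ord_recl big_ord0 /= mul0rn scale0r !hornerE /=.
  by rewrite add0r addr0.
rewrite expr0n mulr0.
(* At 0 the powers of k and of -k merge into (-1)^k k^(m+1), up to a common sign. *)
have := alternating_binomial_sum (ltnSn m.+1).
move=> /(congr1 ( *%R ((-1) ^+ m.+2))); rewrite mulr0 => sum0.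
rewrite -[RHS]sum0 big_distrr; apply: eq_bigr => k _ /=.
rewrite hornerZ horner_exp hornerD hornerX hornerN hornerC add0r.
rewrite mulrnAl mulrnAr; congr (_ *+ _).
have lekm : (k <= m.+2)%N by rewrite -ltnS.
rewrite (exprNn k%:R) [RHS]mulrA -exprD.
case: (nat_of_ord k) lekm => [|i] /= lekm.
  by rewrite mul0r expr0n !mulr0.
rewrite mulrCA -exprD; congr (_ * _).
  rewrite -signr_odd -[RHS]signr_odd; congr (_ ^+ nat_of_bool _); lia.
by congr (_ ^+ _); lia.
Qed.

(** The coefficients of T^j/(1 - T). *)
Definition forest (j : nat) : hseries F := fun n => (n ^_ j)%:R * n%:R ^+ (n - j).

(** Abel's identity of degree n - j evaluated at n, multiplied by the falling factorial of n of
    order j. *)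
Lemma tree_forest j : tree * forest j = forest j.+1.
Proof.
apply: hseriesP => n; rewrite hME /forest.
have [ltnj|lejn] := ltnP n j.
  rewrite !ffact_small ?mul0r ?(leqW ltnj) // big1 // => k _.
  by rewrite ffact_small ?mul0r ?mulr0 ?mul0rn //; lia.
have /(congr1 (fun p => (n ^_ j)%:R * p.[n%:R])) := abel_poly (n - j).
rewrite hornerZ hornerXn horner_sum big_distrr /= mulrA -natrM -ffactnSr subnS.
move=> <-; rewrite (big_ord_widen n.+1 (fun k => (n ^_ j)%:R *
  ((tree k *+ 'C(n - j, k)) *: ('X - (k%:R)%:P) ^+ (n - j - k)).[n%:R])); last lia.
rewrite [RHS]big_mkcond; apply: eq_bigr => -[k /= ltkn] _.
case: ltnP => [ltk|lek]; last first.
  by rewrite ffact_small ?mul0r ?mulr0 ?mul0rn //; lia.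
have binE : ('C(n, k) * (n - k) ^_ j = n ^_ j * 'C(n - j, k))%N.
  apply/eqP; rewrite -(eqn_pmul2r (fact_gt0 k)) mulnAC bin_ffact.
  rewrite -mulnA bin_ffact.
  rewrite -(eqn_pmul2r (fact_gt0 (n - j - k))) -!mulnA ffact_fact; last lia.
  have -> : (n - j - k = n - k - j)%N by lia.
  by rewrite !ffact_fact //; lia.
rewrite hornerZ horner_exp hornerD hornerX hornerN hornerC -natrB; last lia.
rewrite (_ : n - j - k = n - k - j)%N; last lia.
transitivity (tree k * (n - k)%:R ^+ (n - k - j) * ('C(n, k) * (n - k) ^_ j)%:R).
  by rewrite natrM -[LHS]mulr_natr; ring.
by rewrite binE natrM -[tree k *+ _]mulr_natr; ring.
Qed.


(** The series u = 1/(1 - T), see [tree_seq_inv]; its constant term is 0^0 = 1. *)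
Definition tree_seq : hseries F := fun n => n%:R ^+ n.
Notation T := tree.
Notation u := tree_seq.

Lemma tree_seq_forest : u = forest 0.
Proof. by apply: hseriesP => n; rewrite /forest ffactn0 mul1r subn0. Qed.

Lemma tree_seqE : u = 1 + T * u.
Proof.
rewrite [in RHS]tree_seq_forest tree_forest; apply: hseriesP => -[|n].
  by rewrite hDE h1E /forest mul0r addr0.
by rewrite hDE h1E add0r /forest ffactn1 subn1 -exprS.
Qed.

Lemma tree_seq_inv : u * (1 - T) = 1.
Proof. by rewrite mulrBr mulr1 [u * T]mulrC {1}tree_seqE addrK. Qed.

Lemma htheta_tree : htheta T = u - 1.
Proof.
apply: hseriesP => -[|n]; rewrite hDE hNE h1E /htheta /u /T.
  by rewrite expr0 subrr.
by rewrite subr0 exprSr mulr_natr.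
Qed.

Lemma htheta_tree_seq : htheta u = u ^+ 3 - u ^+ 2.
Proof.
have uv := tree_seq_inv; set v := 1 - T in uv.
have dv : htheta v = 1 - u.
  apply: (@addrI _ (htheta T)); rewrite -hthetaD /v addrC subrK htheta1.
  by rewrite htheta_tree; ring.
have := htheta1 F; rewrite -uv hthetaM dv => du.
have -> : htheta u = (htheta u * v + u * (1 - u)) * u + (u ^+ 3 - u ^+ 2)
                     - htheta u * (u * v - 1) by ring.
by rewrite du uv; ring.
Qed.

(** Expand u^2 as the sum of T^j u. The remainder T^(n+1) u^2 has order at least n + 1 and does not
    reach the coefficient n. *)
Lemma tree_seq_sqr n : (u ^+ 2) n = \sum_(j < n.+1) forest j n.
Proof.
have Tu j : forest j = T ^+ j * u.
  elim: j => [|j IHj]; first by rewrite mul1r tree_seq_forest.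
  by rewrite -tree_forest IHj exprS mulrA.
have sqrE : u ^+ 2 = u + T * u ^+ 2 by rewrite {1}expr2 {1}tree_seqE; ring.
have step m : u ^+ 2 = \sum_(j < m) T ^+ j * u + T ^+ m * u ^+ 2.
  elim: m => [|m IHm]; first by rewrite big_ord0 add0r mul1r.
  rewrite big_ord_recr /= {1}IHm -addrA; congr (_ + _).
  by rewrite (exprS _ m) [in LHS]sqrE; ring.
rewrite (step n.+1) hDE hsumE (@hmul_order _ _ _ n.+1 0) ?addn0 //; last first.
  exact: hexp_order.
by rewrite addr0; apply: eq_bigr => j _; rewrite Tu.
Qed.

End TreeSeries.

(** * Solution of Wright's recursion *)

Section ListPolynomials.

(** Coefficient lists over binary integers, constant term first, so that polynomial identities can
    be decided by evaluation. *)
Fixpoint padd (p r : seq Z) : seq Z :=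
  match p, r with
  | [::], _ => r
  | _, [::] => p
  | a :: p', b :: r' => (a + b) :: padd p' r'
  end.

Definition pscale (c : Z) (p : seq Z) : seq Z := map ( *%R c) p.

Definition pmul (p r : seq Z) : seq Z :=
  foldr (fun c acc => padd (pscale c r) (0 :: acc)) [::] p.

(* If u v = 1, theta u = u^3 - u^2 and [p] represents the polynomial p(u), then
   v * (ptheta p)(u) = theta (v * p(u)). *)
Fixpoint ptheta (p : seq Z) : seq Z :=
  if p is c :: p' then
    padd [:: 0; c; - c]
      (padd (0 :: 0 :: padd (0 :: p') (pscale (-1) p')) (0 :: ptheta p'))
  else [::].

Lemma ptheta_cons c p : ptheta (c :: p) =
  padd [:: 0; c; - c]
    (padd (0 :: 0 :: padd (0 :: p) (pscale (-1) p)) (0 :: ptheta p)).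
Proof. by []. Qed.

(** The operator theta (theta - 1) ... (theta - s + 1) = z^s D^s. *)
Fixpoint pffact (s : nat) (p : seq Z) : seq Z :=
  if s is r.+1 then
    padd (ptheta (pffact r p)) (pscale (- r%:R) (pffact r p))
  else p.

Definition psum (n : nat) (f : nat -> seq Z) : seq Z :=
  foldr (fun i acc => padd (f i) acc) [::] (iota 0 n).

Variables (K : comNzRingType) (x : K).

Definition peval (p : seq Z) : K :=
  foldr (fun c acc => (int_of_Z c)%:~R + x * acc) 0 p.

Lemma peval_add p r : peval (padd p r) = peval p + peval r.
Proof.
elim: p r => [|a p IHp] [|b r]; rewrite ?add0r ?addr0 //=.
by rewrite IHp !rmorphD /=; ring.
Qed.

Lemma peval_scale c p : peval (pscale c p) = (int_of_Z c)%:~R * peval p.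
Proof.
elim: p => [|a p IHp]; rewrite ?mulr0 //=.
by rewrite IHp !rmorphM /=; ring.
Qed.

Lemma peval_shift p : peval (0 :: p) = x * peval p.
Proof. by rewrite /= !rmorph0 add0r. Qed.

Lemma peval_mul p r : peval (pmul p r) = peval p * peval r.
Proof.
elim: p => [|a p IHp]; rewrite ?mul0r //.
rewrite [pmul _ _]/= -/(pmul p r) peval_add peval_scale peval_shift IHp /=.
by ring.
Qed.

Lemma peval_sum n f : peval (psum n f) = \sum_(i < n) peval (f i).
Proof.
rewrite -(big_mkord xpredT (fun i => peval (f i))) /index_iota subn0 /psum.
elim: (iota 0 n) => [|i s IHs]; first by rewrite big_nil.
by rewrite big_cons -IHs -peval_add.
Qed.

Lemma peval_eq0 p : all (eq_op 0) p -> peval p = 0.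
Proof.
by elim: p => //= c p IHp /andP[/eqP <- /IHp ->]; rewrite !rmorph0 mulr0 addr0.
Qed.

End ListPolynomials.

Section SeriesEvaluation.
Variable F : numFieldType.
Notation T := (tree F).
Notation u := (tree_seq F).
Notation v := (1 - T).

(** As 1 - T = 1/u, this is a Laurent polynomial in u starting at exponent -1. *)
Definition pseries (p : seq Z) : hseries F := v * peval u p.

Lemma hthetaMint (a : hseries F) (c : int) : htheta (c%:~R * a) = c%:~R * htheta a.
Proof.
rewrite hthetaM; have -> : htheta (c%:~R) = 0 :> hseries F.
  case: c => m; rewrite ?NegzE ?mulrNz; first by rewrite -pmulrn hthetaMn htheta1 mul0rn.
  apply: (@addrI _ (htheta (m.+1%:~R))); rewrite -hthetaD subrr htheta0.
  by rewrite addr0 -pmulrn hthetaMn htheta1 mul0rn.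
by rewrite mul0r add0r.
Qed.

Lemma pseries_theta p : pseries (ptheta p) = htheta (pseries p).
Proof.
have uv := tree_seq_inv F; have dT := htheta_tree F; have du := htheta_tree_seq F.
have dv : htheta v = 1 - u.
  apply: (@addrI _ (htheta T)); rewrite -hthetaD [T + _]addrC subrK htheta1 dT.
  by ring.
rewrite /pseries; elim: p => [|c p IHp]; first by rewrite mulr0 htheta0.
rewrite ptheta_cons !(peval_add, peval_shift, peval_scale).
rewrite [peval u (c :: p)]/= [peval u [:: c; - c]]/=.
rewrite [X in _ = htheta X]mulrDr [in RHS]hthetaD [v * (int_of_Z c)%:~R]mulrC.
rewrite hthetaMint dv.
have -> : v * (u * peval u p) = u * (v * peval u p) by ring.
have zN (a : Z) : (int_of_Z (- a))%:~R = - (int_of_Z a)%:~R :> hseries F.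
  by rewrite rmorphN mulrNz.
rewrite [in RHS]hthetaM -IHp du !zN.
have -> : 1 - u = v * (u - u ^+ 2) by rewrite mulrBr expr2 [v * (u * u)]mulrA [v * u]mulrC uv mul1r.
by ring.
Qed.

Lemma pseries_ffact s p n : pseries (pffact s p) n = pseries p n *+ n ^_ s.
Proof.
elim: s => [|s IHs] //=; rewrite /pseries peval_add peval_scale mulrDr hDE.
rewrite -!/(pseries _) pseries_theta /htheta IHs.
have -> : (int_of_Z (- s%:R))%:~R = - s%:R :> hseries F.
  by rewrite rmorphN mulrNz rmorph_nat mulrz_nat.
rewrite [v * _]mulrCA -/(pseries _) mulNr hNE hnatME IHs ffactnSr.
have [lesn|ltns] := leqP s n; last first.
  by rewrite ffact_small // mul0n !mulr0n mul0rn mulr0 subr0.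
rewrite mulr_natl -mulrnA mulnC; apply/eqP; rewrite subr_eq -mulrnA.
by rewrite -mulrnDr -mulnDr subnK // mulnC.
Qed.

End SeriesEvaluation.

(* Row j lists the coefficients of 420^j p_j, where A_j = (1 - T) p_j(u); the factor
   420^j clears the denominators of p_j and of 1/(i + 1)! in the recursion. *)
Definition solution : seq (seq Z) :=
  [:: [:: -1; 1];
   [:: -210; 630; -630; 210];
   [:: 14700; -7350; -7350; -191100; 470400; -389550; 110250];
   [:: -3087000; 1543500; 1543500; 35500500; -165154500; 532507500;
    -1069645500; 1168429500; -640552500; 138915000];
   [:: 821142000; -399766500; -421375500; -9318881250; 52752971250;
    -229876542000; 778053654000; -2038711909500; 3863851267500; -4819185157500;
    3663319747500; -1529512031250; 268626881250];
   [:: -245046060000; 115716195000; 129329865000; 2814626272500;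
    -17737477537500; 89719757662500; -378672172357500; 1357720805385000;
    -4059240169635000; 9839779160400000; -18425834609490000; 25023292499362500;
    -23207421781687500; 13761747023062500; -4678422780937500; 692255119500000];
   [:: 78323981400000; -35887146750000; -42436834650000; -917379842400000;
    6208381848375000; -34488926410837500; 165656587700362500;
    -704807660647125000; 2644472913755400000; -8660967192466312500;
    24295795454892937500; -56885660474381550000; 107171821420582275000;
    -155251705618229062500; 165122903710898437500; -122938461407026125000;
    60178406309673750000; -17328124549043437500; 2219868428695312500]]%BZ.

Definition sol j := nth [::] solution j.

(** The division is exact in the range used, by [ode_weightE]. *)
Definition ode_weight i : Z := Z.div (420%BZ ^+ i) (i.+1)`!%:R.

(** The left side of the recursion carries one factor 1/u and the right side two; multiplying by u^2
    leaves a polynomial identity in u. *)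
Definition residual j : seq Z :=
  padd (pmul [:: 0; 1] (padd (ptheta (sol j)) (pscale (-1) (sol j))))
    (pscale (-1) (psum j.+1 (fun l => pmul (sol l) (psum (j - l).+1
       (fun i => pscale (ode_weight i) (pffact i.+1 (sol (j - l - i)))))))).

Lemma residual_sol : all (fun j => all (eq_op 0) (residual j)) (iota 0 7).
Proof. by vm_compute. Qed.

Lemma ode_weightE i : (i < 7)%N -> ode_weight i * (i.+1)`!%:R = 420%BZ ^+ i.
Proof. by do 7!case: i => [//|i]. Qed.

(** Since u = 1 + z + ..., the values p(1) and p'(1) are the first two coefficients of p(u). *)
Definition pval1 (p : seq Z) : Z := foldr +%R 0 p.
Definition pder1 (p : seq Z) : Z :=
  (foldr (fun c ab => (c + ab.1, ab.1 + ab.2)) (0, 0) p).2.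

Lemma sol_init j : (j < 7)%N ->
  pval1 (sol j) = 0 /\ pder1 (sol j) - pval1 (sol j) = (j == 0%N)%:R.
Proof. by do 7!case: j => [//|j]. Qed.

Section AreaSeriesSolution.
Variable F : numFieldType.
Notation T := (tree F).
Notation u := (tree_seq F).
Notation v := (1 - T).

(** At index n the left side is (n - 1) X_j(n). For n >= 2 the right side involves only smaller
    indices, because X_l(0) = 0 and [hbin i.+1] kills the constant term. Index 1 is not determined
    and must be prescribed. *)
Lemma ode_unique (c : nat -> nat) J (X Y : nat -> hseries F) :
    let ode (X : nat -> hseries F) := forall j, (j < J)%N ->
      htheta (X j) - X j = \sum_(l < j.+1) X l *
        \sum_(i < (j - l).+1) (c i)%:R * hbin i.+1 (X (j - l - i)%N) in
    ode X -> ode Y ->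
    (forall j, (j < J)%N -> X j 0%N = 0) -> (forall j, (j < J)%N -> Y j 0%N = 0) ->
    (forall j, (j < J)%N -> X j 1%N = Y j 1%N) ->
  forall j, (j < J)%N -> X j = Y j.
Proof.
move=> ode odeX odeY X0 Y0 XY1.
suff XY n j : (j < J)%N -> X j n = Y j n.
  by move=> j ltjJ; apply: hseriesP => n; apply: XY.
elim/ltn_ind: n j => -[|[|n]] IHn j ltjJ; [by rewrite X0 ?Y0 | exact: XY1 |].
have rhs : (htheta (X j) - X j) n.+2 = (htheta (Y j) - Y j) n.+2.
  rewrite odeX // odeY // !hsumE; apply: eq_bigr => l _; rewrite !hME.
  have := ltn_ord l; rewrite ltnS => lelj.
  apply: eq_bigr => -[[|k] /= ltkn] _.
    by rewrite X0 ?Y0 ?mul0r //; lia.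
  have hbinE i (Z : hseries F) m : ((c i)%:R * hbin i.+1 Z) m
      = (c i)%:R * (Z m *+ 'C(m, i.+1)) by rewrite hnatME.
  have [kn|nk] := eqVneq k n.+1.
    rewrite kn subnn !hsumE !big1 ?mulr0 // => i _.
    by rewrite hbinE bin0n mulr0n mulr0.
  rewrite (IHn k.+1) //; try lia; congr (_ * _ *+ _).
  rewrite !hsumE; apply: eq_bigr => i _; rewrite !hbinE IHn //; first by lia.
  by have := ltn_ord i; lia.
move: rhs; rewrite !hDE !hNE /htheta !(mulrSr _ n.+1) !addrK => /eqP.
by rewrite -subr_eq0 -mulrnBl mulrn_eq0 /= subr_eq0 => /eqP.
Qed.

Lemma hintE (z : int) n : (z%:~R : hseries F) n = if n == 0%N then z%:~R else 0.
Proof.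
case: z => m; first by rewrite -pmulrn hnatE.
by rewrite NegzE !mulrNz hNE -!pmulrn hnatE; case: ifP => //; rewrite oppr0.
Qed.

Lemma hintME (z : int) (a : hseries F) n : (z%:~R * a) n = z%:~R * a n.
Proof.
by case: z => m; rewrite ?NegzE ?mulrNz ?mulNr ?hNE -!pmulrn hnatME.
Qed.

Lemma pseries_init p :
  pseries F p 0%N = (int_of_Z (pval1 p))%:~R /\
  pseries F p 1%N = (int_of_Z (pder1 p - pval1 p)%R)%:~R.
Proof.
have hM0 (a b : hseries F) : (a * b) 0%N = a 0%N * b 0%N.
  by rewrite hME big_ord1 bin0.
have hM1 (a b : hseries F) : (a * b) 1%N = a 0%N * b 1%N + a 1%N * b 0%N.
  by rewrite hME !big_ord_recl big_ord0 addr0.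
have pu : peval u p 0%N = (int_of_Z (pval1 p))%:~R /\
          peval u p 1%N = (int_of_Z (pder1 p))%:~R.
  rewrite /pder1; elim: p => [//|c p [IH0 IH1]] /=.
  have ab1 : (foldr (fun c (ab : Z * Z) => (c + ab.1, ab.1 + ab.2)) (0, 0) p).1
             = pval1 p by elim: p {IH0 IH1} => //= a p ->.
  rewrite !hDE !hintE hM0 hM1 IH0 IH1 ab1 /= !rmorphD /= /tree_seq.
  by rewrite expr0 expr1 !mul1r add0r [X in _ /\ X = _]addrC.
have [pu0 pu1] := pu; rewrite /pseries hM0 hM1 pu0 pu1 !hDE !hNE !h1E /=.
by rewrite subr0 sub0r !mul1r mulN1r !rmorphB.
Qed.

Lemma area_series_sol j : (j < 7)%N ->
  (420 ^ j)%:R * area_series F j = pseries F (sol j).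
Proof.
have hbinMn i m (a : hseries F) : hbin i (m%:R * a) = m%:R * hbin i a.
  by apply: hseriesP => n; rewrite /hbin !hnatME mulrnAr.
(* Scaling A_j by 420^j leaves the factor 420^i on the term with A_l and A_(j-l-i). *)
apply: (@ode_unique (fun i => 420 ^ i)%N 7
  (fun j => (420 ^ j)%:R * area_series F j) (fun j => pseries F (sol j))).
- move=> {}j lt7.
  have -> (m : nat) (a : hseries F) : htheta (m%:R * a) = m%:R * htheta a.
    by rewrite !mulr_natl hthetaMn.
  rewrite -mulrBr area_series_ode big_distrr; apply: eq_bigr => l _ /=.
  rewrite mulrCA -[RHS]mulrA [RHS]mulrCA; congr (_ * _).
  rewrite !big_distrr; apply: eq_bigr => i _ /=.
  rewrite hbinMn !mulrA -!natrM -!expnD; congr ((_ ^ _)%:R * _).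
  by have := ltn_ord l; have := ltn_ord i; lia.
- move=> {}j lt7; have /allP/(_ j) := residual_sol.
  rewrite mem_iota => /(_ lt7) /(peval_eq0 u).
  rewrite /residual peval_add peval_mul peval_add !peval_scale peval_sum.
  have -> : (int_of_Z (-1))%:~R = -1 :> hseries F by [].
  have -> : peval u [:: 0; 1] = u.
    rewrite [LHS](_ : _ = 0 + u * (1 + u * 0)); last by congr (_ + _ * (_ + _)).
    by rewrite mulr0 addr0 mulr1 add0r.
  move=> res.
  have uv := tree_seq_inv F.
  rewrite -pseries_theta.
  transitivity (v * (v * \sum_(i < j.+1) peval u (pmul (sol i) (psum (j - i).+1
    (fun k => pscale (ode_weight k) (pffact k.+1 (sol (j - i - k)))))))).
    move: res; set S := \sum_(i < _) _; set p := peval u (sol j).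
    rewrite /pseries -/p; set dp := peval u _ => res.
    have -> : S = u * (dp - p).
      by apply/eqP; rewrite eq_sym -subr_eq0 -[X in _ == X]res; apply/eqP; ring.
    rewrite [RHS](_ : _ = (u * v) * (v * (dp - p))); last by ring.
    by rewrite uv mul1r mulrBr.
  rewrite mulrA big_distrr; apply: eq_bigr => l _ /=.
  rewrite peval_mul peval_sum /pseries mulrACA -/(pseries _ _); congr (_ * _).
  rewrite big_distrr; apply: eq_bigr => i _ /=; rewrite peval_scale mulrCA.
  rewrite -[padd _ _]/(pffact i.+1 (sol (j - l - i))).
  rewrite -/(pseries F (pffact i.+1 (sol (j - l - i)))).
  apply: hseriesP => n; rewrite hintME hnatME pseries_ffact.
  have lt_i : (i < 7)%N by have := ltn_ord i; lia.
  have -> : (420 ^ i)%:R = (int_of_Z (ode_weight i))%:~R * (i.+1)`!%:R :> F.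
    transitivity ((int_of_Z (ode_weight i * (i.+1)`!%:R)%R)%:~R : F).
      by rewrite ode_weightE // !rmorphXn natrX.
    by rewrite !rmorphM !rmorph_nat.
  by rewrite -mulrA /hbin mulr_natl -mulrnA bin_ffact.
- by move=> {}j _; rewrite hnatME area_series_0 mulr0.
- move=> {}j lt7; have [-> _] := pseries_init (sol j).
  by have [-> _] := sol_init lt7.
- move=> {}j lt7; have [_ ->] := pseries_init (sol j).
  have [_ ->] := sol_init lt7; rewrite hnatME area_series_1.
  case: j lt7 => [|j] lt7 /=; first by rewrite mul1r.
  by rewrite mulr0.
Qed.

End AreaSeriesSolution.

(** * Exact moments *)

Section ExactMoments.
Variable F : numFieldType.
Notation T := (tree F).
Notation u := (tree_seq F).

(** Coefficient form of theta u^m = m (u^(m+2) - u^(m+1)) at m = k + 1. *)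
Lemma tree_seq_exp_rec k n :
  (u ^+ k.+3) n = (u ^+ k.+2) n + n%:R / k.+1%:R * (u ^+ k.+1) n.
Proof.
have du m : htheta (u ^+ m) = m%:R * (u ^+ m.+2 - u ^+ m.+1).
  elim: m => [|m IHm]; first by rewrite expr0 htheta1 mul0r.
  rewrite exprS hthetaM IHm htheta_tree_seq -natr1 !exprS; ring.
have /(congr1 (@^~ n)) := du k.+1; rewrite hnatME hDE hNE /htheta => du_n.
apply/eqP; rewrite addrC -subr_eq mulrAC mulr_natl du_n mulrAC mulfV ?mul1r // pnatr_eq0.
Qed.

(** With N = n + 1, reversing [tree_seq_sqr] gives the sum of N! N^i/i! for i <= N. The terms i < n
    form the sum in [E1]; the last two are each N^(n+1). *)
Lemma tree_seq_sqr_E1 n :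
  (u ^+ 2) n.+1 = n.+1%:R ^+ n * (2%:R * E1 F n + n%:R + 2%:R * n.+1%:R).
Proof.
set N := n.+1%:R : F.
have N_neq0 : N != 0 by rewrite pnatr_eq0.
have -> : (u ^+ 2) n.+1 = \sum_(i < n.+2) n.+1`!%:R * (N ^+ i / i`!%:R).
  rewrite tree_seq_sqr (reindex_inj rev_ord_inj); apply: eq_bigr => i _ /=.
  have lein : (i <= n.+1)%N by rewrite -ltnS.
  rewrite /forest subSS subKn // mulrCA mulrC; congr (_ * _).
  apply: (canRL (mulfK _)); first by rewrite pnatr_eq0 -lt0n fact_gt0.
  by rewrite -natrM -[in i`!](subKn lein) ffact_fact // leq_subr.
rewrite !big_ord_recr -big_distrr /= /E1 -/N.
set S := \sum_(i < n) _.
have f0 k : k`!%:R != 0 :> F by rewrite pnatr_eq0 -lt0n fact_gt0.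
rewrite factS natrM -/N exprS.
by field; rewrite f0 expf_neq0 //= -(natrD _ 1) pnatr_eq0.
Qed.

(** A pair stands for a_1(N) + a_2(N) G, where G will be the coefficient N of u^2 divided by
    N^(N-1). *)
Definition lin_add (a b : seq Z * seq Z) := (padd a.1 b.1, padd a.2 b.2).
Definition lin_scale (c : Z) (a : seq Z * seq Z) := (pscale c a.1, pscale c a.2).
Definition lin_shift (a : seq Z * seq Z) := (0 :: a.1, 0 :: a.2).
Definition lin_eval (N G : F) (a : seq Z * seq Z) := peval N a.1 + peval N a.2 * G.

(** The product (j + 1) ... (j + size p), clearing the denominators from [tree_seq_exp_rec]. *)
Fixpoint rising (p : seq Z) (j : nat) : Z :=
  if p is _ :: p' then j.+1%:R * rising p' j.+1 else 1.

(* If [a] and [b] represent j! [u^(j+1)]_n and (j+1)! [u^(j+2)]_n as polynomials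
   in n, linear in a second parameter, then [lin_comb p j a b] represents
   j! * rising p j * [u^(j+1) * p(u)]_n. *)
Fixpoint lin_comb (p : seq Z) (j : nat) (a b : seq Z * seq Z) : seq Z * seq Z :=
  if p is c :: p' then
    lin_add (lin_scale (c * rising p j) a)
      (lin_comb p' j.+1 b (lin_scale j.+2%:R (lin_add b (lin_shift a))))
  else ([::], [::]).

Lemma lin_combE n p j x G a b : let N := n%:R in
    j`!%:R * (u ^+ j.+1) n = x * lin_eval N G a ->
    j.+1`!%:R * (u ^+ j.+2) n = x * lin_eval N G b ->
  (j`!%:R * (int_of_Z (rising p j))%:~R) * (u ^+ j.+1 * peval u p) n
  = x * lin_eval N G (lin_comb p j a b).
Proof.
move=> N; elim: p j a b => [|z p IHp] j a b ua ub.
  by rewrite /= mulr0 /lin_eval /= mul0r addr0 !mulr0.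
have uc : j.+2`!%:R * (u ^+ j.+3) n =
    x * lin_eval N G (lin_scale j.+2%:R (lin_add b (lin_shift a))).
  have -> : x * lin_eval N G (lin_scale j.+2%:R (lin_add b (lin_shift a)))
      = j.+2%:R * (x * lin_eval N G b + N * (x * lin_eval N G a)).
    rewrite /lin_eval /lin_scale /lin_add /lin_shift !(peval_scale, peval_add).
    by rewrite !peval_shift !rmorph_nat; ring.
  rewrite -ua -ub tree_seq_exp_rec -/N !factS !natrM; field.
  by rewrite -(natrD _ 1) pnatr_eq0.
have IH := IHp _ _ _ ub uc.
have -> : lin_eval N G (lin_comb (z :: p) j a b) =
    (int_of_Z (z * rising (z :: p) j)%R)%:~R * lin_eval N G a +
    lin_eval N G (lin_comb p j.+1 b (lin_scale j.+2%:R (lin_add b (lin_shift a)))).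
  rewrite -[lin_comb (z :: p) j a b]/(lin_add (lin_scale (z * rising (z :: p) j)%R a)
    (lin_comb p j.+1 b (lin_scale j.+2%:R (lin_add b (lin_shift a))))).
  rewrite {1}/lin_add {1}/lin_scale /lin_eval !(peval_scale, peval_add).
  by ring.
rewrite [RHS]mulrDr -IH [X in _ = X + _]mulrCA -ua [peval u (z :: p)]/=.
rewrite [u ^+ j.+1 * (_ + _)]mulrDr hDE [u ^+ _ * _%:~R]mulrC.
rewrite hintME [u ^+ j.+1 * (u * _)]mulrA -exprSr.
rewrite [rising (z :: p) j]/= !rmorphM !rmorph_nat factS natrM /=.
by ring.
Qed.

Definition linear_part (p : seq Z) : seq Z * seq Z :=
  lin_comb p 0 ([:: 0; 1], [::]) ([::], [:: 1]).

(** (1 - T)(c0 + c1 u + u^2 p(u)) = c0 (1 - T) + c1 + u p(u). At the positive index n + 1 the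
    constant c1 vanishes and 1 - T contributes -(n + 1)^n. *)
Lemma pseries_coef n c0 c1 p :
  (int_of_Z (rising p 0))%:~R * pseries F [:: c0, c1 & p] n.+1 =
  n.+1%:R ^+ n *
    (lin_eval n.+1%:R (2%:R * E1 F n + n%:R + 2%:R * n.+1%:R) (linear_part p)
     - (int_of_Z (c0 * rising p 0)%R)%:~R).
Proof.
have uv := tree_seq_inv F.
have -> : pseries F [:: c0, c1 & p] = (int_of_Z c0)%:~R * (1 - T)
     + (int_of_Z c1)%:~R * 1 + u ^+ 1 * peval u p.
  have -> : pseries F [:: c0, c1 & p] = (int_of_Z c0)%:~R * (1 - T)
     + (int_of_Z c1)%:~R * (u * (1 - T)) + (u * (1 - T)) * (u * peval u p).
    by rewrite /pseries /=; ring.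
  by rewrite uv mul1r expr1.
set G := 2%:R * _ + _ + _; set N : F := n.+1%:R.
have u1 : 0`!%:R * (u ^+ 1) n.+1 = N ^+ n * lin_eval N G ([:: 0; 1], [::]).
  rewrite [lin_eval _ _ _](_ : _ = 0 + N * (1 + N * 0) + 0 * G) //.
  by rewrite mul0r addr0 mulr0 addr0 add0r mulr1 mul1r expr1 -exprSr.
have u2 : 1`!%:R * (u ^+ 2) n.+1 = N ^+ n * lin_eval N G ([::], [:: 1]).
  rewrite [lin_eval _ _ _](_ : _ = 0 + (1 + N * 0) * G) //.
  rewrite add0r mulr0 addr0 !mul1r.
  exact: tree_seq_sqr_E1.
have := lin_combE p u1 u2; rewrite mul1r -/(linear_part p) => uE.
rewrite [RHS]mulrBr -uE !rmorphM !hDE !hintME hDE hNE !h1E /= /tree -/N.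
by ring.
Qed.

Lemma area_poly_coef j n : (j < 7)%N ->
  (420 ^ j)%:R * (area_poly F n)`_j * n.+1%:R = pseries F (sol j) n.+1.
Proof.
move=> /(@area_series_sol F) /(congr1 (@^~ n.+1)) <-.
by rewrite hnatME /area_series /hcoef /area_hseries /= coefMn -mulrA mulr_natr.
Qed.

(** The number of parking functions, read off from A_0 = (1 - T)(u - 1) = T. *)
Lemma area_poly_coef0 n : (0 < n)%N -> (area_poly F n)`_0 = n.+1%:R ^+ n.-1.
Proof.
move=> n_gt0; have N_neq0 : n.+1%:R != 0 :> F by rewrite pnatr_eq0.
apply: (mulIf N_neq0); have := @area_poly_coef 0 n isT; rewrite mul1r => ->.
have := pseries_coef n (-1)%BZ 1%BZ [::].
rewrite [rising _ _]/= mulr1z mul1r => ->.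
rewrite -exprSr prednK // /lin_eval /= mul0r addr0 sub0r.
have -> : (int_of_Z (-1 * 1)%R)%:~R = -1 :> F by [].
by rewrite opprK mulr1.
Qed.

Lemma rising_neq0 p j : (int_of_Z (rising p j))%:~R != 0 :> F.
Proof.
elim: p j => [|c p IHp] j /=; first exact: oner_neq0.
rewrite !rmorphM; apply: mulf_neq0; last exact: IHp.
by rewrite !rmorph_nat pnatr_eq0.
Qed.

Lemma factorial_momentE j c0 c1 p n :
    (j < 7)%N -> sol j = [:: c0, c1 & p] -> (0 < n)%N ->
  area_factorial_moment F n j =
    j`!%:R / (420%:R ^+ j * (int_of_Z (rising p 0))%:~R) *
    (lin_eval n.+1%:R (2%:R * E1 F n + n%:R + 2%:R * n.+1%:R) (linear_part p)
     - (int_of_Z (c0 * rising p 0)%R)%:~R).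
Proof.
move=> lt_j sol_j n_gt0; rewrite area_factorial_momentE area_poly_coef0 //.
have N_neq0 : n.+1%:R != 0 :> F by rewrite pnatr_eq0.
have := area_poly_coef n lt_j; rewrite sol_j.
move=> /(congr1 ( *%R (int_of_Z (rising p 0))%:~R)).
rewrite pseries_coef natrX => /(congr1 ( *%R (n.+1%:R ^+ n)^-1)).
rewrite [RHS]mulKf ?expf_neq0 // => <-.
have -> : n.+1%:R ^+ n = n.+1%:R * n.+1%:R ^+ n.-1 :> F by rewrite -exprS prednK.
have k_neq0 : (420 : F) ^+ j != 0 by rewrite expf_neq0 // pnatr_eq0.
have := rising_neq0 p 0; move: (int_of_Z _)%:~R k_neq0.
move: (420%:R ^+ j) => k r k_neq0 r_neq0.
by field; rewrite expf_neq0 //= -(natrD _ 1) pnatr_eq0 k_neq0 r_neq0.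
Qed.

Definition sixth_moment_formula (n E : F) : F :=
      82825%:R / 576576%:R * n ^+ 9
      + 373340075%:R / 110702592%:R * n ^+ 8
      + 9401544029%:R / 332107776%:R * n ^+ 7
      + 14473244813%:R / 127733760%:R * n ^+ 6
      + 414139396709%:R / 1660538880%:R * n ^+ 5
      + 88215445651%:R / 332107776%:R * n ^+ 4
      - 18783816473%:R / 332107776%:R * n ^+ 3
      - 643359542029%:R / 1660538880%:R * n ^+ 2
      - 358936540409%:R / 1660538880%:R * n
      + (- (3955%:R / 2048%:R) * n ^+ 7
         - 186349%:R / 6144%:R * n ^+ 6
         - 259283273%:R / 1161216%:R * n ^+ 5
         - 119912501%:R / 129024%:R * n ^+ 4
         - 149860633081%:R / 63866880%:R * n ^+ 3
         - 601794266581%:R / 166053888%:R * n ^+ 2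
         - 864000570107%:R / 276756480%:R * n
         - 921390308389%:R / 830269440%:R) * E.

Lemma sixth_moment_formulaE (n E : F) :
  720%:R / (420%:R ^+ 6 * (int_of_Z (rising (drop 2 (sol 6)) 0))%:~R) *
    (lin_eval (n + 1) (2%:R * E + n + 2%:R * (n + 1)) (linear_part (drop 2 (sol 6)))
     - (int_of_Z (nth 0 (sol 6) 0 * rising (drop 2 (sol 6)) 0)%R)%:~R) = sixth_moment_formula n E.
Proof.
(* Naming the closed integer terms lets [vm_compute] evaluate them without touching the abstract
   field. *)
have [l lE] : exists l, linear_part (drop 2 (sol 6)) = l by eexists.
have [r rE] : exists r, rising (drop 2 (sol 6)) 0 = r by eexists.
have [c cE] : exists c, nth 0 (sol 6) 0 * rising (drop 2 (sol 6)) 0 = c by eexists.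
rewrite lE cE rE; vm_compute in lE, rE, cE; rewrite -{}lE -{}rE -{}cE.
rewrite /sixth_moment_formula /lin_eval /peval /foldr /fst /snd.
by field.
Qed.

Lemma sixth_moment n : (0 < n)%N ->
  area_factorial_moment F n 6 = sixth_moment_formula n%:R (E1 F n).
Proof.
move=> n_gt0; rewrite -sixth_moment_formulaE natr1.
exact: (@factorial_momentE 6 _ (nth 0 (sol 6) 1)).
Qed.

End ExactMoments.

(** * Growth of the first moment *)

Section FirstMomentBound.
Variable R : realType.
Implicit Types f g : nat -> R.

(* With q_j = N(N-1)...(N-j+1)/N^j one has j q_j = N (q_j - q_(j+1)), which
   telescopes, while q_j <= 1 makes S (S - 1) <= 2 \sum_j j q_j for S = \sum_j q_j. *)
Lemma ffact_ratio_sum_bound N (S : R) : (0 < N)%N ->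
  S = \sum_(j < N.+1) (N ^_ j)%:R / N%:R ^+ j -> S * (S - 1) <= 2%:R * N%:R.
Proof.
move=> N_gt0 ->; pose q j : R := (N ^_ j)%:R / N%:R ^+ j.
have N0 : 0 < N%:R :> R by rewrite ltr0n.
have q_ge0 j : 0 <= q j by rewrite divr_ge0 // exprn_ge0.
have qS j : j%:R * q j = N%:R * (q j - q j.+1).
  rewrite /q ffactnSr natrM exprS.
  have [lejN|ltNj] := leqP j N; last by rewrite ffact_small // !mul0r subrr !mulr0.
  by rewrite natrB //; field; rewrite expf_neq0 //= gt_eqF.
have q_le1 j : q j <= 1.
  elim: j => [|j IHj]; first by rewrite /q expr0 divr1.
  apply: le_trans IHj; rewrite -subr_ge0 -(pmulr_rge0 _ N0) -qS.
  by rewrite mulr_ge0.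
have sum_jq m : \sum_(j < m) j%:R * q j <= N%:R.
  have -> : \sum_(j < m) j%:R * q j = N%:R * (1 - q m).
    elim: m => [|m IHm].
      by rewrite big_ord0 /q expr0 divr1 subrr mulr0.
    by rewrite big_ord_recr IHm /= qS; ring.
  by have := q_ge0 m; nra.
have bound m : let s := \sum_(j < m) q j in
    s <= m%:R /\ s * (s - 1) <= 2%:R * \sum_(j < m) j%:R * q j.
  elim: m => [|m [IH1 IH2]] /=; first by rewrite !big_ord0 mul0r mulr0.
  rewrite !big_ord_recr /= -natr1; have := q_ge0 m; have := q_le1 m.
  move: IH1 IH2; set s := \sum_(j < m) q j; set w := \sum_(j < m) _.
  move: (q m) => x s_le sw x1 x0; split; first by lra.
  (* Adding x to s increases s (s - 1) by 2 x s + x^2 - x, which is at most 2 m x. *)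
  have : x * s <= x * m%:R by rewrite ler_wpM2l.
  by nra.
have [_ sw] := bound N.+1; apply: le_trans sw _.
by rewrite ler_pM2l ?ltr0n.
Qed.

(** By [tree_seq_sqr_E1], 2 E_1 differs from (n + 1) S by a linear term, and S = O(sqrt n) by
    [ffact_ratio_sum_bound]. *)
Lemma E1_bound n : (0 < n)%N -> `|E1 R n| <= 6%:R * (n%:R * Num.sqrt n%:R).
Proof.
move=> n_gt0; set s := Num.sqrt _.
pose S : R := \sum_(j < n.+2) (n.+1 ^_ j)%:R / n.+1%:R ^+ j.
have Sb := @ffact_ratio_sum_bound n.+1 S isT erefl.
have N_neq0 : n.+1%:R != 0 :> R by rewrite pnatr_eq0.
have SE : S * n.+1%:R = 2%:R * E1 R n + n%:R + 2%:R * n.+1%:R.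
  apply: (@mulfI _ (n.+1%:R ^+ n)); first by rewrite expf_neq0.
  rewrite -tree_seq_sqr_E1 tree_seq_sqr mulrCA -exprSr big_distrl.
  apply: eq_bigr => j _; rewrite /forest /=.
  have lejn : (j <= n.+1)%N by rewrite -ltnS.
  have -> : n.+1%:R ^+ n.+1 = n.+1%:R ^+ j * n.+1%:R ^+ (n.+1 - j) :> R.
    by rewrite -exprD subnKC.
  by rewrite mulrA divfK // expf_neq0.
have s2 : s ^+ 2 = n%:R by rewrite sqr_sqrtr.
have n1 : 1 <= n%:R :> R by rewrite ler1n.
have s1 : 1 <= s by rewrite -[X in X <= _]sqrtr1 ler_wsqrtr.
have S0 : 0 <= S by apply: sumr_ge0 => j _; rewrite divr_ge0 // exprn_ge0.
have N1 : n.+1%:R = n%:R + 1 :> R by rewrite natr1.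
rewrite N1 in Sb SE.
(* Otherwise S (S - 1) > 9 n - 3 s >= 6 n, while the bound is 2 (n + 1) <= 4 n. *)
have S3 : S <= 3%:R * s.
  by rewrite leNgt; apply/negP => ltS; nra.
have sn : s ^+ 3 = n%:R * s by rewrite exprS s2 mulrC.
have E_eq : E1 R n = (S * (n%:R + 1) - n%:R - 2%:R * (n%:R + 1)) / 2%:R.
  by rewrite SE; field.
have Sn0 : 0 <= S * (n%:R + 1) by rewrite mulr_ge0 // addr_ge0.
have Sn : S * (n%:R + 1) <= 6%:R * (n%:R * s).
  have -> : 6%:R * (n%:R * s) = 3%:R * s * (2%:R * n%:R) by ring.
  by apply: ler_pM => //; lra.
have ns : n%:R <= n%:R * s by rewrite ler_peMr.
rewrite ler_norml E_eq; apply/andP; split; lra.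
Qed.

(** The order n^(17/2), written without real exponents. *)
Definition dominated f := exists2 C : R, 0 < C &
  forall n, (0 < n)%N -> `|f n| <= C * (n%:R ^+ 8 * Num.sqrt n%:R).

Lemma dominatedD f g : dominated f -> dominated g ->
  dominated (fun n => f n + g n).
Proof.
move=> [C C0 fC] [D D0 gD]; exists (C + D); first exact: addr_gt0.
by move=> n n_gt0; rewrite (le_trans (ler_normD _ _)) // mulrDl lerD ?fC ?gD.
Qed.

Lemma dominatedZ c f : dominated f -> dominated (fun n => c * f n).
Proof.
move=> [C C0 fC]; exists ((`|c| + 1) * C).
  by rewrite mulr_gt0 // ltr_wpDl.
move=> n n_gt0; rewrite normrM -mulrA.
apply: ler_pM => //; first by rewrite lerDl.
exact: fC.
Qed.

Lemma dominatedX i : (i <= 8)%N -> dominated (fun n => n%:R ^+ i).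
Proof.
move=> lei; exists 1 => // n n_gt0; rewrite mul1r.
have n1 : 1 <= n%:R :> R by rewrite ler1n.
have s1 : 1 <= Num.sqrt n%:R :> R by rewrite -[X in X <= _]sqrtr1 ler_wsqrtr.
rewrite ger0_norm ?exprn_ge0 //; apply: (@le_trans _ _ (n%:R ^+ 8)).
  by rewrite ler_weXn2l.
by rewrite ler_peMr // exprn_ge0.
Qed.

(** Degree 7 is the limit, as 7 + 3/2 = 17/2. *)
Lemma dominatedXE i : (i <= 7)%N -> dominated (fun n => n%:R ^+ i * E1 R n).
Proof.
move=> lei; exists 6%:R => // n n_gt0.
have n1 : 1 <= n%:R :> R by rewrite ler1n.
rewrite normrM ger0_norm ?exprn_ge0 //.
have -> : 6%:R * (n%:R ^+ 8 * Num.sqrt n%:R)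
   = n%:R ^+ 7 * (6%:R * (n%:R * Num.sqrt n%:R)) :> R by rewrite exprSr; ring.
by apply: ler_pM; rewrite ?exprn_ge0 ?normr_ge0 ?E1_bound ?ler_weXn2l.
Qed.

End FirstMomentBound.

Theorem theorem6 (R : realType) :
  (forall n : nat, (1 <= n)%N ->
    area_factorial_moment R n 6 =
      82825%:R / 576576%:R * n%:R ^+ 9
      + 373340075%:R / 110702592%:R * n%:R ^+ 8
      + 9401544029%:R / 332107776%:R * n%:R ^+ 7
      + 14473244813%:R / 127733760%:R * n%:R ^+ 6
      + 414139396709%:R / 1660538880%:R * n%:R ^+ 5
      + 88215445651%:R / 332107776%:R * n%:R ^+ 4
      - 18783816473%:R / 332107776%:R * n%:R ^+ 3
      - 643359542029%:R / 1660538880%:R * n%:R ^+ 2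
      - 358936540409%:R / 1660538880%:R * n%:R
      + (- (3955%:R / 2048%:R) * n%:R ^+ 7
         - 186349%:R / 6144%:R * n%:R ^+ 6
         - 259283273%:R / 1161216%:R * n%:R ^+ 5
         - 119912501%:R / 129024%:R * n%:R ^+ 4
         - 149860633081%:R / 63866880%:R * n%:R ^+ 3
         - 601794266581%:R / 166053888%:R * n%:R ^+ 2
         - 864000570107%:R / 276756480%:R * n%:R
         - 921390308389%:R / 830269440%:R) * E1 R n)
  /\ (fun n : nat => area_factorial_moment R n 6)
       = (fun n : nat => 82825%:R / 576576%:R * n%:R ^+ 9)
         +O_\oo (fun n : nat => n%:R `^ (17%:R / 2%:R)).
Proof.
split; first exact: sixth_moment.
(* All terms but the leading one, as a sum of scalar multiples; the exponents 1 and 0 are kept so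
   that every term has the form required by [dominatedX] or [dominatedXE]. *)
pose remainder (x E : R) :=
    373340075%:R / 110702592%:R * x ^+ 8
    + 9401544029%:R / 332107776%:R * x ^+ 7
    + 14473244813%:R / 127733760%:R * x ^+ 6
    + 414139396709%:R / 1660538880%:R * x ^+ 5
    + 88215445651%:R / 332107776%:R * x ^+ 4
    + (- (18783816473%:R / 332107776%:R)) * x ^+ 3
    + (- (643359542029%:R / 1660538880%:R)) * x ^+ 2
    + (- (358936540409%:R / 1660538880%:R)) * x ^+ 1
    + (- (3955%:R / 2048%:R)) * (x ^+ 7 * E)
    + (- (186349%:R / 6144%:R)) * (x ^+ 6 * E)
    + (- (259283273%:R / 1161216%:R)) * (x ^+ 5 * E)
    + (- (119912501%:R / 129024%:R)) * (x ^+ 4 * E)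
    + (- (149860633081%:R / 63866880%:R)) * (x ^+ 3 * E)
    + (- (601794266581%:R / 166053888%:R)) * (x ^+ 2 * E)
    + (- (864000570107%:R / 276756480%:R)) * (x ^+ 1 * E)
    + (- (921390308389%:R / 830269440%:R)) * (x ^+ 0 * E).
have remainderE x E : sixth_moment_formula x E - 82825%:R / 576576%:R * x ^+ 9
    = remainder x E by rewrite /sixth_moment_formula /remainder; field.
have [C C0 remC] : dominated (fun n => remainder n%:R (E1 R n)).
  by do !apply: dominatedD; apply: dominatedZ;
    first [exact: dominatedX | exact: dominatedXE].
apply/eqaddOP/bigO_exP; exists C => //; exists 1%N => // n /= n_gt0.
have -> : n%:R `^ (17%:R / 2%:R) = n%:R ^+ 8 * Num.sqrt n%:R :> R.
  have -> : 17%:R / 2%:R = 8%:R + 2^-1 :> R by field.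
  rewrite powRD ?pnatr_eq0 -?lt0n ?n_gt0 ?implybT //.
  by rewrite powR_mulrn // powR12_sqrt.
rewrite [X in _ <= _ * X]ger0_norm; last by rewrite mulr_ge0 ?exprn_ge0 ?sqrtr_ge0.
suff -> : ((fun m => area_factorial_moment R m 6)
    - (fun m => 82825%:R / 576576%:R * m%:R ^+ 9)) n
    = remainder n%:R (E1 R n) by exact: remC.
by rewrite -remainderE -sixth_moment.
Qed.
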